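(* Let $n\ge 1$, let $\Omega\subset\mathbb{R}^n$ be a bounded smooth domain, let $0<s<1$ and $1<q<2^*_s$. Let $c>0$ be a constant such that $$c\,\|w\|_{q;\Omega}^2\le \tfrac12 [w]_{s;\Omega}^2\qquad\text{for every } w\in H^s(\Omega) \text{ with } \int_\Omega w\,dx=0.$$ For $\varepsilon>0$ let $\Omega_\varepsilon=\{\varepsilon x: x\in\Omega\}$, and let $\varepsilon_0\in(0,\infty]$ be the supremum of all $\delta>0$ such that for every $0<\varepsilon<\delta$ the extremal for $S(\Omega_\varepsilon)$ is unique up to multiplication by a nonzero real constant. Then $$\varepsilon_0\ge\left(\frac{c}{(q-1)\,|\Omega|^{1-\frac2q}}\right)^{\frac1{2s}}.$$
   Context: A domain is a nonempty connected open set; $|\Omega|$ is Lebesgue measure. $2^*_s:=\frac{2n}{n-2s}$ if $2s<n$ and $2^*_s:=\infty$ otherwise. For an open set $U\subset\mathbb{R}^n$, $\|u\|_{r;U}$ denotes the $L^r(U)$-norm, $[u]_{s;U}:=\left(\iint_{U\times U}\frac{(u(x)-u(y))^2}{|x-y|^{n+2s}}\,dx\,dy\right)^{1/2}$, $H^s(U):=\{u\in L^2(U): [u]_{s;U}<\infty\}$ (real-valued functions), with norm $\|u\|_{s;U}:=([u]_{s;U}^2+\|u\|_{2;U}^2)^{1/2}$. The Sobolev constant is $$S(U):=\inf_{u\in H^s(U),\,u\neq 0}\frac{\|u\|_{s;U}^2}{\|u\|_{q;U}^2},$$ and an extremal for $S(U)$ is a nonzero $u\in H^s(U)$ at which this infimum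 is attained. A constant $c$ as in the claim exists (Poincaré-type inequality), and the set of admissible $\delta$ defining $\varepsilon_0$ is nonempty. *)

(* Defs.v *)
From HB Require Import structures.
From mathcomp Require Import all_boot all_order all_algebra.
From mathcomp Require Import all_classical all_reals all_analysis.

Set Implicit Arguments.
Unset Strict Implicit.
Unset Printing Implicit Defensive.

Import Order.TTheory GRing.Theory Num.Theory.
Import numFieldNormedType.Exports.

Local Open Scope classical_set_scope.
Local Open Scope ring_scope.

(* 'rV[R]_n carries the sigma-algebra generated by the n coordinate maps,
   i.e. the Borel sigma-algebra of R^n (cf. the library's n.-tuple T). *)
Definition rV_display : measure_display.
Proof. exact: default_measure_display. Qed.

Section measurable_rV.
Context (R : realType) (n : nat).

Definition rV_coord (i : 'I_n) (x : 'rV[R]_n) : measurableTypeR R := x ord0 i.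

Let rV_measurable : set (set 'rV[R]_n) := g_sigma_preimage rV_coord.

Let rV_measurable0 : rV_measurable set0.
Proof. exact: sigma_algebra0. Qed.

Let rV_measurableC A : rV_measurable A -> rV_measurable (~` A).
Proof. exact: sigma_algebraC. Qed.

Let rV_measurable_bigcup (F : (set 'rV[R]_n)^nat) :
  (forall i, rV_measurable (F i)) -> rV_measurable (\bigcup_i F i).
Proof. exact: sigma_algebra_bigcup. Qed.

HB.instance Definition _ := @isMeasurable.Build rV_display 'rV[R]_n
  rV_measurable rV_measurable0 rV_measurableC rV_measurable_bigcup.

End measurable_rV.

Section cons_rV.
Context (R : realType) (n : nat).

Definition cons_rV (p : measurableTypeR R * 'rV[R]_n) : 'rV[R]_n.+1 :=
  row_mx (\row_(_ < 1) p.1) p.2.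

Definition uncons_rV (x : 'rV[R]_n.+1) : measurableTypeR R * 'rV[R]_n :=
  (x ord0 ord0, \row_i x ord0 (lift ord0 i)).

Lemma cons_rV0 p : cons_rV p ord0 ord0 = p.1.
Proof.
rewrite /cons_rV.
have -> : ord0 = @lshift 1 n ord0 by apply/val_inj.
by rewrite (row_mxEl (\row_(_ < 1) p.1) p.2) mxE.
Qed.

Lemma cons_rVS p i : cons_rV p ord0 (lift ord0 i) = p.2 ord0 i.
Proof.
rewrite /cons_rV.
have -> : lift ord0 i = @rshift 1 n i by apply/val_inj.
by rewrite (row_mxEr (\row_(_ < 1) p.1) p.2).
Qed.

Lemma cons_rVK : cancel cons_rV uncons_rV.
Proof.
move=> [a y]; rewrite /uncons_rV cons_rV0; congr (_, _).
by apply/rowP => i; rewrite mxE cons_rVS.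
Qed.

Lemma uncons_rVK : cancel uncons_rV cons_rV.
Proof.
move=> x; apply/rowP => i; case: (unliftP ord0 i) => [j ->|->].
  by rewrite cons_rVS mxE.
by rewrite cons_rV0.
Qed.

End cons_rV.

Section measurable_cons_rV.
Context (R : realType).

Lemma measurable_rV_coord n (i : 'I_n) :
  measurable_fun [set: 'rV[R]_n] (rV_coord i).
Proof.
move=> _ Y mY; rewrite setTI; apply: sub_sigma_algebra => /=.
rewrite -bigcup_seq/=; exists i => /=; first by rewrite mem_index_enum.
by exists Y => //; rewrite setTI.
Qed.

Lemma measurable_fun_rV d (T : measurableType d) n (f : T -> 'rV[R]_n) :
  (forall i, measurable_fun [set: T] (fun t => rV_coord i (f t))) ->
  measurable_fun [set: T] f.
Proof.
move=> mf _ A mA; rewrite setTI.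
suff: g_sigma_preimage (@rV_coord R n) `<=` [set B | measurable (f @^-1` B)].
  by apply; exact: mA.
apply: smallest_sub => /=.
  split => /=; first by rewrite preimage_set0.
    by move=> B mB; rewrite setTD -preimage_setC; exact: measurableC.
  by move=> F mF; rewrite preimage_bigcup; exact: bigcup_measurable.
move=> B; rewrite -bigcup_seq/= => -[i _ [C mC <-]] /=.
by rewrite setTI -comp_preimage -[X in measurable X]setTI; exact: mf.
Qed.

Lemma measurable_cons_rV n : measurable_fun setT (@cons_rV R n).
Proof.
apply: measurable_fun_rV => i.
have [j ->|->] := unliftP ord0 i.
  rewrite [X in measurable_fun _ X](_ : _ = rV_coord j \o snd).
    by apply: measurableT_comp => //; exact: measurable_rV_coord.
  by apply/funext => p; rewrite /rV_coord cons_rVS.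
rewrite [X in measurable_fun _ X](_ : _ = fst)//.
by apply/funext => p; rewrite /rV_coord cons_rV0.
Qed.

Lemma measurable_uncons_rV n : measurable_fun setT (@uncons_rV R n).
Proof.
apply: measurable_fun_pair; first exact: measurable_rV_coord.
apply: measurable_fun_rV => i.
rewrite [X in measurable_fun _ X](_ : _ = @rV_coord R n.+1 (lift ord0 i)).
  exact: measurable_rV_coord.
by apply/funext => x; rewrite /rV_coord mxE.
Qed.

End measurable_cons_rV.

Section lebesgue_rV.
Context (R : realType).
Local Open Scope ereal_scope.

Section step.
Context (n : nat) (mu : {sigma_finite_measure set 'rV[R]_n -> \bar R}).

Definition lebesgue_cons : set 'rV[R]_n.+1 -> \bar R :=
  pushforward (@lebesgue_measure R \x mu) (@cons_rV R n).

Let lebesgue_cons0 : lebesgue_cons set0 = 0.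
Proof. by rewrite /lebesgue_cons /pushforward preimage_set0 measure0. Qed.

Let lebesgue_cons_ge0 A : 0 <= lebesgue_cons A.
Proof. by rewrite /lebesgue_cons /pushforward; exact: measure_ge0. Qed.

Let lebesgue_cons_sigma_additive : semi_sigma_additive lebesgue_cons.
Proof.
have mf := @measurable_cons_rV R n.
move=> F mF tF mUF; rewrite /lebesgue_cons /pushforward preimage_bigcup.
apply: measure_semi_sigma_additive.
- by move=> k; rewrite -[X in measurable X]setTI; exact: mf.
- apply/trivIsetP => /= i j _ _ ij; rewrite -preimage_setI.
  by move/trivIsetP : tF => /(_ _ _ _ _ ij) ->//; rewrite preimage_set0.
- by rewrite -preimage_bigcup -[X in measurable X]setTI; exact: mf.
Qed.

HB.instance Definition _ := isMeasure.Build _ _ _ lebesgue_cons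
  lebesgue_cons0 lebesgue_cons_ge0 lebesgue_cons_sigma_additive.

Let lebesgue_cons_sigma_finite : sigma_finite setT lebesgue_cons.
Proof.
have /sigma_finiteP[F [FT ndF Foo]] := sigma_finiteT (@lebesgue_measure R).
have /sigma_finiteP[G [GT ndG Goo]] := sigma_finiteT mu.
exists (fun k => @uncons_rV R n @^-1` (F k `*` G k)).
  apply/seteqP; split=> // x _.
  have [i _ Fi] : (\bigcup_k F k) (uncons_rV x).1 by rewrite -FT.
  have [j _ Gj] : (\bigcup_k G k) (uncons_rV x).2 by rewrite -GT.
  exists (maxn i j) => //; split => /=.
  - by move: Fi; exact/subsetPset/ndF/leq_maxl.
  - by move: Gj; exact/subsetPset/ndG/leq_maxr.
move=> k; have [mF oF] := Foo k; have [mG oG] := Goo k; split.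
  by rewrite -[X in measurable X]setTI; apply: measurable_uncons_rV => //;
     exact: measurableX.
rewrite /lebesgue_cons /pushforward -comp_preimage.
rewrite (_ : _ \o _ = id); last by apply/funext => p /=; rewrite cons_rVK.
by rewrite preimage_id product_measure1E// lte_mul_pinfty// ge0_fin_numE.
Qed.

HB.instance Definition _ := Measure_isSigmaFinite.Build _ _ _ lebesgue_cons
  lebesgue_cons_sigma_finite.

End step.

(* n-dimensional Lebesgue measure as the n-fold product of the 1-dimensional
   one; on the one-point space R^0 it is the unit mass. *)
Fixpoint lebesgue_rV (n : nat) : {sigma_finite_measure set 'rV[R]_n -> \bar R} :=
  match n with
  | 0 => dirac (0%R : 'rV[R]_0)
  | n'.+1 => lebesgue_cons (lebesgue_rV n')
  end.

End lebesgue_rV.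

Section domains.
Context (R : realType) (n : nat).
Implicit Types U V W : set 'rV[R]_n.

(* The norm of the library on 'rV[R]_n is the sup norm. *)
Definition euclidean_norm (x : 'rV[R]_n) : R :=
  Num.sqrt (\sum_(i < n) x ord0 i ^+ 2).

(* f is C^oo on the open set V: all iterated directional derivatives of f
   are Frechet differentiable at every point of V. *)
Definition smooth_on V (f : 'rV[R]_n -> R) : Prop :=
  forall vs : seq 'rV[R]_n, forall x, V x ->
    differentiable (foldr (fun v g y => 'D_v g y) f vs) x.

(* Every boundary point of U has a neighbourhood V on which U is given by
   rho < 0 for some C^oo function rho with nowhere vanishing differential. *)
Definition smooth_boundary U : Prop :=
  forall p, (closure U `\` interior U) p ->
  exists V (rho : 'rV[R]_n -> R),
    [/\ open_nbhs p V,
        smooth_on V rho,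
        (forall x, V x -> exists v, 'D_v rho x != 0) &
        U `&` V = [set x | rho x < 0] `&` V].

Definition bounded_smooth_domain U : Prop :=
  [/\ U !=set0, open U, connected U, bounded_set U & smooth_boundary U].

Definition dilation (e : R) U : set 'rV[R]_n := [set e *: x | x in U].

End domains.

Section fractional_sobolev.
Context (R : realType) (n : nat).
Local Open Scope ereal_scope.
Local Notation mu := (lebesgue_rV R n).
Implicit Types (U : set 'rV[R]_n) (u v : 'rV[R]_n -> R) (s q r : R).

Definition volume U : R := fine (mu U).

Definition critical_exponent s : \bar R :=
  if (2 * s < n%:R)%R then ((2 * n%:R) / (n%:R - 2 * s))%:E else +oo.

(* Functions on U are represented by functions on R^n whose values outside U
   are irrelevant; measurability is with respect to Borel sets, and equality
   of functions is equality almost everywhere on U. *)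
Definition eq_on U u v : Prop := u = v %[ae mu in U].

Definition Lr_norm r U u : \bar R := 'N[mu]_(r%:E)[(EFin \o u) \_ U].

Definition gagliardo s U u : \bar R :=
  (\int[mu \x mu]_(z in U `*` U)
     ((u z.1 - u z.2) ^+ 2 /
      euclidean_norm (z.1 - z.2) `^ (n%:R + 2 * s))%:E) `^ 2^-1.

Definition Hs s U u : Prop :=
  [/\ measurable_fun U u, Lr_norm 2 U u < +oo & gagliardo s U u < +oo].

Definition Hs_norm s U u : \bar R :=
  (gagliardo s U u ^+ 2 + Lr_norm 2 U u ^+ 2) `^ 2^-1.

Definition nonzero_on U u : Prop := ~ eq_on U u (cst 0%R).

(* A quotient with infinite denominator is 0, since +oo^-1 = 0 in \bar R; the
   denominator is never 0 for a nonzero u. *)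
Definition sobolev_quotient s q U u : \bar R :=
  Hs_norm s U u ^+ 2 / Lr_norm q U u ^+ 2.

Definition sobolev_constant s q U : \bar R :=
  ereal_inf [set sobolev_quotient s q U u | u in
               [set u | Hs s U u /\ nonzero_on U u]].

Definition is_extremal s q U u : Prop :=
  [/\ Hs s U u, nonzero_on U u &
      sobolev_quotient s q U u = sobolev_constant s q U].

(* "The extremal is unique up to a nonzero factor" asserts existence as well. *)
Definition unique_extremal s q U : Prop :=
  exists2 u, is_extremal s q U u &
    forall v, is_extremal s q U v ->
      exists2 k : R, k != 0%R & eq_on U v (k \*o u).

Definition poincare_constant s q U (c : R) : Prop :=
  forall w, Hs s U w -> \int[mu]_(x in U) (w x)%:E = 0 ->
    c%:E * Lr_norm q U w ^+ 2 <= (2^-1)%:E * gagliardo s U w ^+ 2.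

Definition uniqueness_threshold s q U : \bar R :=
  ereal_sup [set delta%:E | delta in
    [set delta : R | (0 < delta)%R /\
       forall e : R, (0 < e < delta)%R ->
         unique_extremal s q (dilation e U)]].

End fractional_sobolev.

(* Main.v *)
(* No compactness is needed: below the threshold the extremals are exactly the
   nonzero constants.  Let m be the mean of w and v = w - m.  For q >= 2 the
   pointwise bound |m + v|^q <= (m^2 + 2(q-1)v^2)^(q/2) + C_m v, integrated
   and followed by Minkowski's inequality in L^(q/2), gives
     |w|_q^2 <= m^2 |U|^(2/q) + 2(q-1) |v|_q^2,
   and the Poincare inequality absorbs the last term into [w]_s^2, leaving a
   positive multiple of |v|_q^2; for q < 2 the same follows from Jensen's
   inequality.  Hence the quotient is at least |U|^(1-2/q), its value at the
   constants, with equality only if v = 0.  The Poincare constant of the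
   dilated domain is obtained by scaling. *)
Require Import Defs.
From mathcomp Require Import all_boot all_order all_algebra.
From mathcomp Require Import all_classical all_reals all_analysis.
From mathcomp Require Import measurable_realfun ring lra.
Import Order.TTheory GRing.Theory Num.Theory.
Import numFieldNormedType.Exports.
Set Implicit Arguments.
Unset Strict Implicit.
Unset Printing Implicit Defensive.
Local Open Scope classical_set_scope.
Local Open Scope ring_scope.

(** * Pointwise inequalities for real powers *)

Section power_inequalities.
Context {R : realType}.
Implicit Types a b m q r t v x : R.

(** Young's inequality for the product [t * 1] with conjugate exponents [r] and [r / (r - 1)];
    [r = 1] is an equality. *)
Lemma powR_bernoulli r t : 1 <= r -> 0 <= t -> 1 + r * (t - 1) <= t `^ r.
Proof.
move=> r1 t0; have [->|rN1] := eqVneq r 1; first by rewrite powRr1//; lra.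
have {rN1}r1 : 1 < r by rewrite lt_neqAle eq_sym rN1.
have r0 : 0 < r by lra.
have r10 : 0 < r - 1 by lra.
have rc : r^-1 + (r / (r - 1))^-1 = 1 by field; rewrite !gt_eqF.
have := conjugate_powR t0 ler01 r0 (divr_gt0 r0 r10) rc.
rewrite powR1 mulr1 => /(ler_wpM2l (ltW r0)) h.
have -> : t `^ r = r * (t `^ r / r + 1 / (r / (r - 1))) - (r - 1).
  by field; rewrite !gt_eqF.
lra.
Qed.

Lemma powR_tangent r a b : 1 <= r -> 0 < a -> 0 <= b ->
  a `^ r + r * a `^ (r - 1) * (b - a) <= b `^ r.
Proof.
move=> r1 a0 b0; have ba0 : 0 <= b / a by rewrite divr_ge0// ltW.
have -> : b = b / a * a by rewrite divfK// gt_eqF.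
rewrite [leRHS](powRM _ ba0 (ltW a0)) -(mulr_powRB1 (ltW a0) (lt_le_trans ltr01 r1)).
have -> : a * a `^ (r - 1) + r * a `^ (r - 1) * (b / a * a - a) =
  (1 + r * (b / a - 1)) * (a * a `^ (r - 1)) by ring.
by rewrite ler_wpM2r ?powR_bernoulli// mulr_ge0 ?powR_ge0// ltW.
Qed.

(** Split [(a + b)^r] as [a (a + b)^(r-1) + b (a + b)^(r-1)] and use monotonicity of the power
    [r - 1] in each term. *)
Lemma powR_superadditive r a b : 1 <= r -> 0 <= a -> 0 <= b ->
  a `^ r + b `^ r <= (a + b) `^ r.
Proof.
move=> r1 a0 b0; have r0 : 0 < r by lra.
rewrite -!(mulr_powRB1 _ r0)// ?addr_ge0// mulrDl.
have r10 : 0 <= r - 1 by lra.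
by apply: lerD; apply: ler_wpM2l => //;
  apply: ge0_ler_powR => //; rewrite ?nnegrE ?addr_ge0 ?lerDl ?lerDr.
Qed.

Lemma powR_sqr_half q x : 0 <= q -> (x ^+ 2) `^ (q / 2) = `|x| `^ q.
Proof.
move=> q0; rewrite -normr_id -real_normK ?num_real// -powR_mulrn// -powRrM.
by rewrite normr_id mulrC divfK.
Qed.

(** The case [m = 1] of the two-term bound. [q * x] is the first-order part of the left side at [0],
    and the factor [2] doubles the second-order coefficient, which gives the slack to cover every
    [x]. Three ranges of [x] are treated by different convexity arguments. *)
Lemma powR_1D_le q x : 2 <= q ->
  `|1 + x| `^ q <= (1 + 2 * (q - 1) * x ^+ 2) `^ (q / 2) + q * x.
Proof.
move=> q2; set B := 1 + _ * _.
have q0 : 0 <= q by lra.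
have r1 : 1 <= q / 2 by lra.
have B1 : 1 <= B by rewrite /B lerDl mulr_ge0 ?sqr_ge0//; lra.
have BE : B = (1 + x) ^+ 2 + (- 2 * x + (2 * q - 3) * x ^+ 2) by rewrite /B; ring.
have Bern : 1 + q * (q - 1) * x ^+ 2 <= B `^ (q / 2).
  apply: le_trans (powR_bernoulli r1 (le_trans ler01 B1)).
  by rewrite le_eqVlt; apply/orP; left; apply/eqP; rewrite /B; field.
(* For [0 < x], the tangent to [t^(q/2)] at [t = (1 + x)^2] reduces the claim to
   [(1 + x)^(q-2) * (1 - (q - 3/2) x) <= 1]. *)
have [x0|x0] := ltP 0 x.
  have a0 : 0 < (1 + x) ^+ 2 by rewrite exprn_gt0//; lra.
  have := powR_tangent r1 a0 (le_trans ler01 B1).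
  rewrite powR_sqr_half// -lerBrDr => /le_trans; apply.
  rewrite lerD2l lerNl.
  have -> : q / 2 - 1 = (q - 2) / 2 by field.
  rewrite powR_sqr_half ?ger0_norm; [|lra|lra].
  rewrite -subr_ge0 opprK [in X in _ * X]BE addrAC subrr add0r.
  have -> : q / 2 * (1 + x) `^ (q - 2) * (- 2 * x + (2 * q - 3) * x ^+ 2) + q * x =
     q * x * (1 - (1 + x) `^ (q - 2) * (1 - (q - 3 / 2) * x)) by field.
  apply: mulr_ge0; first by rewrite mulr_ge0// ltW.
  rewrite subr_ge0.
  have [c0|c0] := leP (1 - (q - 3 / 2) * x) 0.
    by rewrite (le_trans _ ler01)// mulr_ge0_le0 ?powR_ge0.
  (* Each factor lies below an exponential, and the two exponents add up to [- x / 2]. *)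
  have h1 : (1 + x) `^ (q - 2) <= expR ((q - 2) * x).
    rewrite /powR gt_eqF; last lra.
    by rewrite ler_expR ler_wpM2l ?subr_ge0// le_ln1Dx//; lra.
  have h2 : 1 - (q - 3 / 2) * x <= expR (- ((q - 3 / 2) * x)) by exact: expR_ge1Dx.
  apply: (le_trans (ler_pM (powR_ge0 _ _) (ltW c0) h1 h2)).
  rewrite -expRD -[leRHS]expR0 ler_expR; lra.
(* For [x <= -1], superadditivity separates [(1 + x)^2] from the rest of [B]; Bernoulli on the rest,
   with [1 <= x^2], leaves only [(q - 1)^2 >= 0] to check. *)
have [x1|x1] := leP x (-1).
  have d1 : 0 <= - 2 * x + (2 * q - 3) * x ^+ 2 by nra.
  have := powR_superadditive r1 (sqr_ge0 (1 + x)) d1.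
  rewrite -BE powR_sqr_half// => h.
  have := powR_bernoulli r1 d1.
  have x2 : 0 <= q * (2 * q - 3) / 2 * (x ^+ 2 - 1).
    by rewrite !mulr_ge0//; [lra|nra].
  have := sqr_ge0 (q - 1); lra.
have u0 : 0 < 1 + x by lra.
have ui0 : 0 <= (1 + x)^-1 by rewrite invr_ge0 ltW.
(* For [-1 < x <= 0], Bernoulli at the inverse of [1 + x] gives
   [(1 + x)^q <= (1 + x) / (1 + x - q x)]. After clearing the denominator, [Bern] leaves the excess
   [q (q - 1)^2 (-x)^3 >= 0]. *)
have := powR_bernoulli (r := q) (ltac:(lra)) ui0.
rewrite gtr0_norm//.
have -> : (1 + x)^-1 `^ q = ((1 + x) `^ q)^-1.
  by rewrite -powR_inv1 ?ltW// -powRrM mulN1r powRN.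
have p0 : 0 < (1 + x) `^ q by rewrite powR_gt0.
have -> : 1 + q * ((1 + x)^-1 - 1) = (1 + x - q * x) / (1 + x).
  by field; rewrite gt_eqF.
have w0 : 0 < 1 + x - q * x by nra.
rewrite -[leLHS]invrK lef_pV2 ?posrE ?invr_gt0 ?divr_gt0// invf_div => h.
apply: (le_trans h); rewrite ler_pdivrMr//.
apply: (@le_trans _ _ ((1 + q * (q - 1) * x ^+ 2 + q * x) * (1 + x - q * x))).
  have -> : (1 + q * (q - 1) * x ^+ 2 + q * x) * (1 + x - q * x) =
    1 + x + q * (q - 1) ^+ 2 * (- x) ^+ 3 by ring.
  by rewrite lerDl !mulr_ge0 ?sqr_ge0 ?exprn_ge0//; lra.
by rewrite ler_wpM2r ?lerD2r// ltW.
Qed.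

(* The coefficient of [v] does not matter: [v] will be integrated to [0]. *)
Lemma powR_normD_le q m v : 2 <= q ->
  `|m + v| `^ q <=
  (m ^+ 2 + 2 * (q - 1) * v ^+ 2) `^ (q / 2) + q * `|m| `^ q * m^-1 * v.
Proof.
move=> q2; have q0 : 0 <= q by lra.
(* At [m = 0] the convention [0^-1 = 0] removes the linear term; otherwise homogeneity reduces to
   [powR_1D_le] at [v / m]. *)
have [->|m0] := eqVneq m 0.
  rewrite invr0 mulr0 mul0r addr0 expr0n/= !add0r -powR_sqr_half//.
  have k1 : 1 <= 2 * (q - 1) by lra.
  apply: ge0_ler_powR; rewrite ?nnegrE ?sqr_ge0//; first by rewrite divr_ge0.
    by apply: mulr_ge0; [lra|exact: sqr_ge0].
  by rewrite ler_peMl ?sqr_ge0.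
have -> : m + v = m * (1 + v / m) by field.
have -> : m ^+ 2 + 2 * (q - 1) * v ^+ 2 =
  m ^+ 2 * (1 + 2 * (q - 1) * (v / m) ^+ 2) by field.
have B0 : 0 <= 1 + 2 * (q - 1) * (v / m) ^+ 2.
  by rewrite addr_ge0// mulr_ge0 ?sqr_ge0//; lra.
rewrite normrM (powRM _ (sqr_ge0 m) B0) powRM//.
rewrite powR_sqr_half//.
have -> : q * `|m| `^ q * m^-1 * v = `|m| `^ q * (q * (v / m)) by field.
by rewrite -mulrDr ler_wpM2l ?powR_ge0// powR_1D_le.
Qed.

End power_inequalities.

(** * Norms over a measurable set: Jensen, Minkowski and the shift inequality *)

Section restricted_Lnorm.
Context d (T : measurableType d) (R : realType).
Variable mu : {measure set T -> \bar R}.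
Variable D : set T.
Hypothesis mD : measurable D.
Implicit Types (u v w : T -> R) (m r q : R).
Local Open Scope ereal_scope.

Local Notation N r u := ('N[mu]_(r%:E)[(EFin \o u) \_ D]).

Lemma Lnorm_restrict r u : (0 < r)%R ->
  N r u = (\int[mu]_(x in D) (`|u x| `^ r)%:E) `^ r^-1.
Proof.
move=> r0; rewrite unlock [in RHS]integral_mkcond; congr (_ `^ _).
apply: eq_integral => x _; rewrite !patchE; case: ifPn => //= _.
by rewrite normr0 powR0// gt_eqF.
Qed.

Lemma sqr_poweR (x : \bar R) r : (x `^ r) ^+ 2 = x `^ (r * 2).
Proof.
rewrite poweRrM; have := poweR_ge0 x r; case: (x `^ r) => [y| |]//=.
  by rewrite lee_fin => y0; rewrite powR_mulrn// -EFin_expe.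
by rewrite gt_eqF// expe2 mulyy.
Qed.

Lemma sqr_Lnorm_restrict r u : (0 < r)%R ->
  N r u ^+ 2 = (\int[mu]_(x in D) (`|u x| `^ r)%:E) `^ (2 / r).
Proof. by move=> r0; rewrite Lnorm_restrict// sqr_poweR mulrC. Qed.

Lemma measurable_normr_powR u r : measurable_fun D u ->
  measurable_fun D (fun x => `|u x| `^ r)%R.
Proof.
move=> mu_.
apply: (@measurableT_comp _ _ _ _ _ _ (@powR R ^~ r)) => //.
exact: measurableT_comp.
Qed.

Lemma Lnorm_restrict_eq0 r u : (0 < r)%R -> measurable_fun D u ->
  N r u = 0 -> u = cst 0%R %[ae mu in D].
Proof.
move=> r0 mu_ /Lnorm_eq0_eq0.
have mu_D : measurable_fun [set: T] ((EFin \o u) \_ D).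
  by apply/(measurable_restrictT _ mD); exact/measurable_EFinP.
move=> /(_ mu_D); rewrite lte_fin => /(_ r0).
by apply: filterS => x /= /(_ I); rewrite patchE => + Dx; rewrite mem_set// => -[].
Qed.

Lemma integral_cst_EFin m : \int[mu]_(x in D) m%:E = m%:E * mu D.
Proof. exact: integral_cst. Qed.

Lemma Lnorm_restrict_cst r m : (0 < r)%R ->
  N r (cst m) ^+ 2 = (m ^+ 2)%:E * mu D `^ (2 / r).
Proof.
move=> r0; rewrite sqr_Lnorm_restrict//= integral_cst_EFin poweRM//.
by congr (_ * _); rewrite poweR_EFin -powRrM mulrC divfK ?gt_eqF//
  powR_mulrn// real_normK ?num_real.
Qed.

(** Hölder's inequality for [|u|^q] and [1] with exponents [2 / q] and [2 / (2 - q)]. The case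
    [q = 2], where the second exponent degenerates, is an equality. *)
Lemma Lnorm_restrict_jensen q u : (0 < q <= 2)%R ->
  measurable_fun D u -> N q u ^+ 2 <= mu D `^ (2 / q - 1) * N 2 u ^+ 2.
Proof.
move=> /andP[q0 q2] mu_.
have [->|qN2] := eqVneq q 2%R.
  by rewrite divff// subrr poweRe0 mul1e.
have {qN2}q2 : (q < 2)%R by rewrite lt_neqAle qN2.
have q20 : (0 < 2 - q)%R by rewrite subr_gt0.
have mf : measurable_fun D (fun x => `|u x| `^ q)%R by exact: measurable_normr_powR.
have cR (g : T -> R) : (EFin \o g) \_ D = EFin \o (g \_ D).
  by apply/funext => x; rewrite /= !patchE; case: ifPn.
pose one : T -> R := cst 1%R; pose uq : T -> R := fun x => (`|u x| `^ q)%R.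
have := @hoelder _ _ _ mu (uq \_ D) (one \_ D)
  (2 / q) (2 / (2 - q)).
have -> : (uq \_ D \* one \_ D)%R = uq \_ D.
  by apply/funext => x; rewrite /= !patchE; case: ifPn; rewrite ?mulr1 ?mulr0.
rewrite -!cR !Lnorm_restrict ?divr_gt0//.
under eq_integral do rewrite /= powRr1// ger0_norm ?powR_ge0//.
under [X in X `^ _ * _]eq_integral.
  move=> x _; rewrite /= ger0_norm ?powR_ge0// -powRrM mulrC divfK ?gt_eqF//.
  over.
under [X in _ * X `^ _]eq_integral do rewrite /= normr1 powR1.
rewrite integral_cst_EFin mul1e invr1 poweRe1; last first.
  by apply: integral_ge0 => x _; rewrite lee_fin powR_ge0.
set I := \int[mu]_(x in D) _; set J := \int[mu]_(x in D) _.
have J0 : 0 <= J by apply: integral_ge0 => x _; rewrite lee_fin powR_ge0.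
have I0 : 0 <= I by apply: integral_ge0 => x _; rewrite lee_fin powR_ge0.
have mr (g : T -> R) : measurable_fun D g -> measurable_fun setT (g \_ D).
  by move=> mg; exact/(measurable_restrictT _ mD).
move=> /(_ (mr _ mf) (mr _ (measurable_cst _)) isT isT).
have -> : ((2 / q)^-1 + (2 / (2 - q))^-1 = 1)%R.
  by field; rewrite !gt_eqF.
move=> /(_ erefl) H.
rewrite !sqr_poweR mulVf// poweRe1// (mulrC (q^-1)%R).
have -> : J = (J `^ (2 / q)^-1) `^ (2 / q).
  by rewrite -poweRrM mulVf ?poweRe1// gt_eqF// divr_gt0.
have -> : (2 / q - 1 = (2 / (2 - q))^-1 * (2 / q))%R by field; rewrite !gt_eqF.
rewrite (poweRrM (mu D)) -poweRM ?poweR_ge0//.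
apply: gt0_ler_poweR; rewrite ?in_itv/= ?leey ?andbT//.
- by rewrite divr_ge0// ltW.
- by rewrite mule_ge0// poweR_ge0.
- by rewrite muleC.
Qed.

Lemma Lnorm_restrict_triangle r u v : (1 <= r)%R ->
  measurable_fun D u -> measurable_fun D v ->
  N r (fun x => u x + v x)%R <= N r u + N r v.
Proof.
move=> r1 mu_ mv.
have cR (g : T -> R) : (EFin \o g) \_ D = EFin \o (g \_ D).
  by apply/funext => x; rewrite /= !patchE; case: ifPn.
have mr (g : T -> R) : measurable_fun D g -> measurable_fun setT (g \_ D).
  by move=> mg; exact/(measurable_restrictT _ mD).
have -> : (EFin \o (fun x => u x + v x)%R) \_ D =
    EFin \o (u \_ D \+ v \_ D)%R.
  by apply/funext => x; rewrite /= !patchE; case: ifPn; rewrite ?addr0.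
by rewrite !cR; exact: (minkowski_EFin _ (mr _ mu_) (mr _ mv) r1).
Qed.

(** Integrating [powR_normD_le] loses its linear term since [v] has integral zero; what remains is
    an [L^(q/2)] norm of a sum of squares, to which the triangle inequality applies because
    [1 <= q / 2]. *)
Lemma Lnorm_restrict_shift_le q m v : (2 <= q)%R -> measurable_fun D v ->
  mu.-integrable D (EFin \o v) -> \int[mu]_(x in D) (v x)%:E = 0 ->
  N q (fun x => m + v x)%R ^+ 2 <=
  (m ^+ 2)%:E * mu D `^ (2 / q) + (2 * (q - 1))%:E * N q v ^+ 2.
Proof.
move=> q2 mv iv v0; have q0 : (0 < q)%R by lra.
have q21 : (1 <= q / 2)%R by lra.
have q20 : (0 < q / 2)%R by lra.
have K0 : (0 <= 2 * (q - 1))%R by lra.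
have mmv : measurable_fun D (fun x => m + v x)%R by exact: measurable_funD.
pose f1 : T -> R := cst (m ^+ 2)%R; pose f2 x := (2 * (q - 1) * v x ^+ 2)%R.
have mf1 : measurable_fun D f1 by exact: measurable_cst.
have mf2 : measurable_fun D f2.
  by apply: measurable_funM => //; exact: measurable_funX.
have f12 x : (0 <= f1 x + f2 x)%R.
  by rewrite addr_ge0 ?sqr_ge0// mulr_ge0 ?sqr_ge0.
have step : \int[mu]_(x in D) (`|m + v x| `^ q)%:E <=
    \int[mu]_(x in D) (`|f1 x + f2 x| `^ (q / 2))%:E.
  set g := fun x => (`|f1 x + f2 x| `^ (q / 2))%:E.
  have mg : measurable_fun D g.
    by apply/measurable_EFinP/measurable_normr_powR; exact: measurable_funD.
  have g0 x : 0 <= g x by rewrite lee_fin powR_ge0.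
  (* Apart from the trivial infinite case, [g] is integrable, so the integral of [g + k v] may be
     split. *)
  have [->|goo] := eqVneq (\int[mu]_(x in D) g x) +oo; first exact: leey.
  have ig : mu.-integrable D g.
    apply/integrableP; split => //.
    by under eq_integral do rewrite gee0_abs//; rewrite ltey.
  set k := (q * `|m| `^ q * m^-1)%R.
  have ikv : mu.-integrable D (fun x => k%:E * (EFin \o v) x).
    exact: integrableZl.
  have <- : \int[mu]_(x in D) (g x + k%:E * (EFin \o v) x) =
      \int[mu]_(x in D) g x.
    by rewrite (integralD mD ig ikv) (integralZl mD iv) v0 mule0 adde0.
  apply: ge0_le_integral => //.
  - by apply/measurable_EFinP; exact: (measurable_normr_powR _ mmv).
  - by apply: emeasurable_funD => //; case/integrableP : ikv.
  - move=> x _; rewrite /g /= -EFinM -EFinD lee_fin (ger0_norm (f12 x)).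
    exact: powR_normD_le.
rewrite !sqr_Lnorm_restrict//.
apply: (@le_trans _ _ ((\int[mu]_(x in D) (`|f1 x + f2 x| `^ (q / 2))%:E)
                        `^ (2 / q))).
  apply: gt0_ler_poweR; rewrite ?in_itv/= ?leey ?andbT//.
  - by rewrite divr_ge0// ltW.
  - by apply: integral_ge0 => x _; rewrite lee_fin powR_ge0.
  - by apply: integral_ge0 => x _; rewrite lee_fin powR_ge0.
(* Read with exponent [q / 2], the right side is the norm of [f1 + f2]; Minkowski separates the
   constant from the multiple of [v^2]. *)
have -> : (2 / q = (q / 2)^-1)%R by field; rewrite gt_eqF.
rewrite -Lnorm_restrict//.
apply: (le_trans (Lnorm_restrict_triangle q21 mf1 mf2)).
rewrite !Lnorm_restrict//; apply: leeD.
  rewrite /f1/= integral_cst_EFin poweRM ?lee_fin ?powR_ge0//.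
  rewrite poweR_EFin -powRrM divff ?gt_eqF// powRr1// ger0_norm ?sqr_ge0//.
under eq_integral.
  move=> x _; rewrite normrM powRM// (ger0_norm K0) normrX -powR_mulrn//.
  rewrite -powRrM (mulrC 2%R (q / 2)%R) divfK// EFinM.
  over.
rewrite ge0_integralZl_EFin ?powR_ge0//; last first.
  by apply/measurable_EFinP; exact: measurable_normr_powR.
have I0 : 0 <= \int[mu]_(x in D) (`|v x| `^ q)%:E.
  by apply: integral_ge0 => x _; rewrite lee_fin powR_ge0.
rewrite (poweRM _ _ I0) ?lee_fin ?powR_ge0//.
by rewrite poweR_EFin -powRrM divff ?gt_eqF// powRr1.
Qed.

End restricted_Lnorm.

(** * Change of variables under maps that scale a measure *)

Section image_scaling.
Local Open Scope ereal_scope.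
Context d (T : measurableType d) (R : realType).

Lemma ge0_integral_scaled (mu : {measure set T -> \bar R}) (phi : T -> T) (c : R)
    (D : set T) (f : T -> \bar R) :
  (0 <= c)%R -> measurable_fun setT phi ->
  (forall A, measurable A -> mu A = c%:E * mu (phi @^-1` A)) ->
  measurable D -> measurable_fun D f -> (forall x, D x -> 0 <= f x) ->
  \int[mu]_(x in D) f x = c%:E * \int[mu]_(x in phi @^-1` D) f (phi x).
Proof.
move=> c0 mphi muE mD mf f0.
have [nu nuE] : exists nu : {measure set T -> \bar R}, nu = pushforward mu phi :> (_ -> _).
  by unshelve eexists (pushforward mu phi : {measure set T -> \bar R}) => //.
rewrite (eq_measure_integral (mscale (NngNum c0) nu)); last first.
  by move=> A mA _; rewrite muE// -[in LHS]/(pushforward mu phi A) -nuE.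
rewrite ge0_integral_mscale// nuE ge0_integral_pushforward//.
by move=> x /[!inE]; exact: f0.
Qed.

(** Serves to pull the zero-mean condition back through a dilation, with no integrability assumed.
    The positive and negative parts scale separately, and since [0 < c] keeps infinite values
    infinite, a vanishing difference forces both parts to be finite. *)
Lemma integral_scaled_eq0 (mu : {measure set T -> \bar R}) (phi : T -> T) (c : R)
    (D : set T) (f : T -> \bar R) :
  (0 < c)%R -> measurable_fun setT phi ->
  (forall A, measurable A -> mu A = c%:E * mu (phi @^-1` A)) ->
  measurable D -> measurable_fun D f ->
  \int[mu]_(x in D) f x = 0 -> \int[mu]_(x in phi @^-1` D) f (phi x) = 0.
Proof.
move=> c0 mphi muE mD mf; rewrite integralE [in X in _ -> X]integralE.
rewrite !(ge0_integral_scaled (ltW c0) mphi muE mD)//;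
  [|exact: measurable_funeneg|exact: measurable_funepos].
pose a := \int[mu]_(x in phi @^-1` D) f^\+ (phi x).
pose b := \int[mu]_(x in phi @^-1` D) f^\- (phi x).
rewrite (funepos_comp f phi : (fun x => f (phi x))^\+ = _).
rewrite (funeneg_comp f phi : (fun x => f (phi x))^\- = _).
change (c%:E * a - c%:E * b = 0 -> a - b = 0).
have : 0 <= a by apply: integral_ge0 => x _; exact: funepos_ge0.
have : 0 <= b by apply: integral_ge0 => x _; exact: funeneg_ge0.
have cy : c%:E * +oo = +oo by rewrite gt0_muley.
case: a => [a| |]; case: b => [b| |]//= _ _; rewrite ?cy//.
by move=> [] /eqP; rewrite -mulrBr mulf_eq0 gt_eqF//= => /eqP ab; rewrite -EFinD ab.
Qed.

End image_scaling.

(** By uniqueness of the product measure it suffices to compare both sides on rectangles, where the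
    two scaling factors multiply. *)
Lemma product_measure_scaled d1 d2 (T1 : measurableType d1)
    (T2 : measurableType d2) (R : realType)
    (m1 : {sigma_finite_measure set T1 -> \bar R})
    (m2 : {sigma_finite_measure set T2 -> \bar R})
    (phi1 : T1 -> T1) (phi2 : T2 -> T2) (c1 c2 : R) :
  0 <= c1 -> 0 <= c2 -> measurable_fun setT phi1 -> measurable_fun setT phi2 ->
  (forall A, measurable A -> m1 A = c1%:E * m1 (phi1 @^-1` A))%E ->
  (forall A, measurable A -> m2 A = c2%:E * m2 (phi2 @^-1` A))%E ->
  forall X, measurable X -> ((m1 \x m2) X =
    (c1 * c2)%:E * (m1 \x m2) ((fun z => (phi1 z.1, phi2 z.2)) @^-1` X))%E.
Proof.
move=> c10 c20 mphi1 mphi2 m1E m2E X mX; set phi := fun z => _.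
have mphi : measurable_fun setT phi.
  by apply: measurable_fun_pair; [exact: measurableT_comp|exact: measurableT_comp].
have [nu nuE] : exists nu : {measure set (T1 * T2) -> \bar R},
    nu = pushforward (m1 \x m2)%E phi :> (_ -> _).
  by unshelve eexists (pushforward (m1 \x m2)%E phi : {measure set _ -> \bar R}) => //.
transitivity (mscale (NngNum (mulr_ge0 c10 c20)) nu X); last first.
  by rewrite /= /mscale nuE.
apply: product_measure_unique => // A B mA mB; rewrite /= /mscale nuE /pushforward.
rewrite (_ : phi @^-1` _ = (phi1 @^-1` A) `*` (phi2 @^-1` B))//.
rewrite product_measure1E//.
- by rewrite (m1E _ mA) (m2E _ mB) muleACA -EFinM.
- by rewrite -[X in measurable X]setTI; exact: mphi1.
- by rewrite -[X in measurable X]setTI; exact: mphi2.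
Qed.

(** * Lebesgue measure on row vectors: boxes, open and bounded sets, scaling *)

Section lebesgue_rV_theory.
Context (R : realType).
Implicit Types n : nat.

Lemma measurable_box n (F : 'I_n -> set R) :
  (forall i, measurable (F i)) -> measurable [set x : 'rV[R]_n | forall i, F i (x ord0 i)].
Proof.
move=> mF.
rewrite (_ : mkset _ = \bigcap_(i in [set: 'I_n]) (rV_coord i @^-1` F i)); last first.
  apply/seteqP; split=> [x Fx i _|x Fx i]; first exact: Fx.
  exact: (Fx i I).
apply: fin_bigcap_measurable => // i _.
by rewrite -[X in measurable X]setTI; apply: measurable_rV_coord => //; exact: mF.
Qed.

Lemma lebesgue_rV_box n (F : 'I_n -> set R) : (forall i, measurable (F i)) ->
  (lebesgue_rV R n [set x : 'rV[R]_n | forall i, F i (x ord0 i)] =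
   \prod_(i < n) lebesgue_measure (F i))%E.
Proof.
elim: n F => [|n IH] F mF.
  by rewrite big_ord0 /= diracE mem_set// => -[].
pose X := [set x : 'rV[R]_n.+1 | forall i, F i (x ord0 i)].
have XE : @cons_rV R n @^-1` X =
    (F ord0 : set (measurableTypeR R)) `*`
    [set x : 'rV[R]_n | forall i, F (lift ord0 i) (x ord0 i)].
  apply/seteqP; split=> -[a y] /=.
    move=> h; split; first by have := h ord0; rewrite cons_rV0.
    by move=> i; have := h (lift ord0 i); rewrite cons_rVS.
  move=> [Fa Fy] i; case: (unliftP ord0 i) => [j ->|->]; rewrite ?cons_rVS ?cons_rV0//.
rewrite big_ord_recl.
rewrite -[LHS]/((lebesgue_measure \x lebesgue_rV R n)%E (@cons_rV R n @^-1` X)) XE.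
have mY := measurable_box (fun i => mF (lift ord0 i)).
by rewrite product_measure1E//; [rewrite (IH (fun i => F (lift ord0 i)))|exact: mF].
Qed.

(** The sigma-algebra comes from the coordinates and the topology from the sup norm, whose balls are
    boxes. An open set is the union of the countably many boxes with rational centre and radius
    [1 / (k + 1)] that it contains. *)
Lemma open_measurable_rV n (A : set 'rV[R]_n) : open A -> measurable A.
Proof.
move=> oA.
pose box (p : 'rV[rat]_n * nat) : set 'rV[R]_n :=
  [set x | forall i, ball (ratr (p.1 ord0 i) : R) p.2.+1%:R^-1 (x ord0 i)].
have -> : A = \bigcup_p (if `[< box p `<=` A >] then box p else set0).
  apply/seteqP; split=> [x Ax|x [p _]]; last by case: asboolP => [bA /bA|_ []].
  have := oA; rewrite openE => /(_ _ Ax); rewrite /interior.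
  rewrite -nbhs_ballE => -[e /= e0 xeA].
  have e20 : 0 < e / 2 by rewrite divr_gt0.
  (* A radius below [e / 2] keeps any box of that radius containing [x] inside the ball of radius
     [e] around [x]. *)
  have [k ke] : exists k : nat, k.+1%:R^-1 < e / 2.
    have [k _ /(_ k (leqnn _))] := near_infty_natSinv_lt (PosNum e20).
    by exists k.
  have k0 : 0 < k.+1%:R^-1 :> R by rewrite invr_gt0.
  have /choice[c xc] : forall i, exists c : rat, ball (ratr c : R) k.+1%:R^-1 (x ord0 i).
    move=> i; have /rat_in_itvoo[c] : x ord0 i < x ord0 i + k.+1%:R^-1 by rewrite ltrDl.
    rewrite in_itv/= => /andP[c1 c2]; exists c; apply: ball_sym.
    rewrite -ball_normE /ball_/= ltr_distlC c2 andbT.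
    by apply: lt_trans c1; rewrite gtrBl.
  pose p : 'rV[rat]_n * nat := (\row_i c i, k).
  exists p => //; case: asboolP => [_ i|]; first by rewrite mxE; exact: xc.
  case=> y py; apply: xeA; split=> // i j; rewrite (ord1 i).
  have := py j; rewrite /= mxE => /(ball_triangle (ball_sym (xc j))).
  by apply: le_ball; rewrite (splitr e) lerD// ltW.
apply: countable_bigcupT_measurable => [|p]; first exact: countableP.
case: asboolP => // _.
apply: (@measurable_box _ (fun i => ball (ratr (p.1 ord0 i) : R) p.2.+1%:R^-1)).
by move=> i; exact: measurable_ball.
Qed.

Lemma lebesgue_rV_bounded n (A : set 'rV[R]_n) : bounded_set A -> measurable A ->
  (lebesgue_rV R n A < +oo)%E.
Proof.
(* [bounded_set] only promises bounds strictly larger than [M], hence the [+ 1]. *)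
move=> [M [Mreal bM]] mA; pose M1 := `|M| + 1.
have bA x : A x -> `|x| <= M1.
  by apply: bM; rewrite /M1 (le_lt_trans (ler_norm M))// ltrDl.
pose B := [set x : 'rV[R]_n | forall i, `[- M1, M1]%classic (x ord0 i)].
have mB : measurable B.
  by apply: (@measurable_box _ (fun=> `[- M1, M1]%classic)) => i; exact: measurable_itv.
apply: (@le_lt_trans _ _ (lebesgue_rV R n B)).
  apply: le_measure; rewrite ?inE// => x /bA xM i /=.
  rewrite in_itv/= -ler_norml; apply: le_trans xM.
  rewrite [`|x|]mx_normrE.
  by apply: (le_trans _ (le_bigmax _ _ (ord0, i))).
rewrite -ge0_fin_numE// (@lebesgue_rV_box _ (fun=> `[- M1, M1]%classic)); last first.
  by move=> i; exact: measurable_itv.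
apply: (big_ind (fun x => x \is a fin_num)) => //; first by move=> *; exact: fin_numM.
by move=> i _; rewrite lebesgue_measure_itv/=; case: ifP.
Qed.

Lemma lebesgue_rV_open_gt0 n (A : set 'rV[R]_n) : open A -> A !=set0 ->
  (0 < lebesgue_rV R n A)%E.
Proof.
move=> oA [x Ax]; have mA := open_measurable_rV oA.
have := oA; rewrite openE => /(_ _ Ax); rewrite /interior.
rewrite -nbhs_ballE => -[e /= e0 xeA].
pose B := [set y : 'rV[R]_n | forall i, ball (x ord0 i) e (y ord0 i)].
have mB : measurable B.
  by apply: (@measurable_box _ (fun i => ball (x ord0 i) e)) => i; exact: measurable_ball.
apply: (@lt_le_trans _ _ (lebesgue_rV R n B)).
  rewrite (@lebesgue_rV_box _ (fun i => ball (x ord0 i) e)); last first.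
    by move=> i; exact: measurable_ball.
  apply: (big_ind (fun x => 0 < x)%E) => //; first by move=> a b; exact: mule_gt0.
  by move=> i _; rewrite lebesgue_measure_ball ?ltW// lte_fin pmulrn_lgt0.
apply: le_measure; rewrite ?inE// => y By; apply: xeA; split=> // i j.
by rewrite (ord1 i); exact: By.
Qed.

(** The right side is a measure in [A] that agrees with length on half-open intervals, so uniqueness
    of Lebesgue measure applies. *)
Lemma lebesgue_measure_scale (e : R) : 0 < e -> forall A : set (measurableTypeR R),
  measurable A ->
  (lebesgue_measure A = e%:E * lebesgue_measure ((fun x : measurableTypeR R => (e * x)%R : measurableTypeR R) @^-1` A))%E.
Proof.
move=> e0 A mA; pose phi : measurableTypeR R -> measurableTypeR R := fun x => (e * x)%R.
have mphi : measurable_fun setT phi by exact: (@measurable_funM _ _ R).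
have [nu nuE] : exists nu : {measure set (measurableTypeR R) -> \bar R},
    nu = pushforward (@lebesgue_measure R) phi :> (_ -> _).
  by unshelve eexists (pushforward (@lebesgue_measure R) phi : {measure set _ -> \bar R}) => //.
transitivity (mscale (NngNum (ltW e0)) nu A); last by rewrite /= /mscale nuE.
apply: lebesgue_measure_unique => // _ [[a b] _ <-]; rewrite /= /mscale nuE /pushforward.
rewrite (_ : _ @^-1` _ = `]a / e, b / e]%classic); last first.
  by apply/seteqP; split=> x /=; rewrite !in_itv/= /phi (mulrC e)
    ltr_pdivrMr// ler_pdivlMr.
rewrite !lebesgue_measure_itv/= !lte_fin ltr_pM2r ?invr_gt0//.
case: ifP => _; rewrite ?mule0// -!EFinD -EFinM -mulrBl mulrC divfK//.
by rewrite gt_eqF.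
Qed.

Lemma measurable_scale n (e : R) : measurable_fun setT (fun x : 'rV[R]_n => e *: x).
Proof.
apply: measurable_fun_rV => i.
rewrite (_ : (fun _ => _) = (fun x => e * rV_coord i x)); last first.
  by apply/funext => x; rewrite /rV_coord mxE.
by apply: measurable_funM => //; exact: measurable_rV_coord.
Qed.

(** Induction on the dimension: [cons_rV] commutes with scaling, so each coordinate contributes a
    factor [e]; in dimension [0] scaling is the identity. *)
Lemma lebesgue_rV_scale n (e : R) : 0 < e -> forall A : set 'rV[R]_n, measurable A ->
  (lebesgue_rV R n A = (e ^+ n)%:E * lebesgue_rV R n ((fun x => e *: x)%R @^-1` A))%E.
Proof.
move=> e0; elim: n => [|n IH] A mA.
  rewrite expr0 mul1e; congr (lebesgue_rV R 0 _).
  by apply/seteqP; split=> x /=; rewrite [e *: x](_ : _ = x)//; apply/rowP => -[].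
have mcA : measurable (@cons_rV R n @^-1` A).
  by rewrite -[X in measurable X]setTI; exact: measurable_cons_rV.
rewrite -[LHS]/((lebesgue_measure \x lebesgue_rV R n)%E (@cons_rV R n @^-1` A)).
rewrite (product_measure_scaled (ltW e0) (exprn_ge0 n (ltW e0)) _ (measurable_scale e)
  (lebesgue_measure_scale e0) IH)//; last exact: measurable_funM.
rewrite -exprS; congr (_ * _)%E; congr (product_measure1 _ _ _).
have consZ (a : R) (y : 'rV[R]_n) : cons_rV (e * a, e *: y) = e *: cons_rV (a, y).
  apply/rowP => i; rewrite [RHS]mxE; case: (unliftP ord0 i) => [j ->|->].
    by rewrite !cons_rVS/= mxE.
  by rewrite !cons_rV0.
by apply/seteqP; split=> -[a y]; rewrite /preimage/= consZ.
Qed.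

End lebesgue_rV_theory.

(** Abstract scaling of a double integral: [c] is the Jacobian in each variable and [b] the
    homogeneity factor of the kernel. *)
Lemma ge0_integral_product_scaled d (T : measurableType d) (R : realType)
    (m : {sigma_finite_measure set T -> \bar R}) (phi : T -> T) (b c : R)
    (D : set T) (k k' : T * T -> R) :
  0 <= b -> 0 <= c -> measurable_fun setT phi ->
  (forall A, measurable A -> m A = c%:E * m (phi @^-1` A))%E ->
  measurable D -> measurable_fun (D `*` D) k ->
  measurable_fun ((phi @^-1` D) `*` (phi @^-1` D)) k' ->
  (forall z, 0 <= k z) -> (forall z, 0 <= k' z) ->
  (forall z, k (phi z.1, phi z.2) = b * k' z) ->
  (\int[m \x m]_(z in D `*` D) (k z)%:E = (c * c * b)%:E *
   \int[m \x m]_(z in (phi @^-1` D) `*` (phi @^-1` D)) (k' z)%:E)%E.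
Proof.
move=> b0 c0 mphi mE mD mk mk' k0 k'0 kk'.
have mphiD : measurable (phi @^-1` D) by rewrite -[X in measurable X]setTI; exact: mphi.
have mDD : measurable (D `*` D) by exact: measurableX.
have mDD' : measurable ((phi @^-1` D) `*` (phi @^-1` D)) by exact: measurableX.
have mphi2 : measurable_fun setT (fun z : T * T => (phi z.1, phi z.2)).
  by apply: measurable_fun_pair; exact: measurableT_comp.
have mkE : measurable_fun (D `*` D) (EFin \o k) by exact/measurable_EFinP.
have mkE' : measurable_fun ((phi @^-1` D) `*` (phi @^-1` D)) (EFin \o k').
  exact/measurable_EFinP.
have kE0 z : (D `*` D) z -> (0 <= (k z)%:E)%E by rewrite lee_fin.
rewrite (ge0_integral_scaled (mulr_ge0 c0 c0) mphi2
  (product_measure_scaled c0 c0 mphi mphi mE mE) mDD mkE kE0).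
rewrite (_ : _ @^-1` _ = (phi @^-1` D) `*` (phi @^-1` D))// (EFinM (c * c) b) -muleA.
congr (_ * _)%E; rewrite -ge0_integralZl_EFin//.
  by apply: eq_integral => z _; rewrite /= kk' EFinM.
by move=> z _; rewrite lee_fin.
Qed.

(** * Behaviour of norms, seminorms and the Poincaré constant under dilation *)

Section dilation_scaling.
Context (R : realType) (n : nat).
Local Open Scope ereal_scope.
Local Notation mu := (lebesgue_rV R n).
Implicit Types (U : set 'rV[R]_n) (u : 'rV[R]_n -> R) (s q r e c : R).

Lemma preimage_dilation e U : (0 < e)%R ->
  (fun x : 'rV[R]_n => (e *: x)%R) @^-1` dilation e U = U.
Proof.
move=> e0; apply/seteqP; split=> [x [y Uy yx]|x Ux]; last by exists x.
by rewrite -(scalerI _ yx)// gt_eqF.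
Qed.

Lemma measurable_dilation e U : (0 < e)%R -> measurable U ->
  measurable (dilation e U).
Proof.
move=> e0 mU; rewrite (_ : dilation e U = (fun x => (e^-1 *: x)%R) @^-1` U).
  by rewrite -[X in measurable X]setTI; exact: measurable_scale.
apply/seteqP; split=> [_ [x Ux <-]|x Ux] /=.
  by rewrite scalerK// gt_eqF.
by exists (e^-1 *: x)%R => //; rewrite scalerKV// gt_eqF.
Qed.

Lemma lebesgue_rV_dilation e U : (0 < e)%R -> measurable U ->
  mu (dilation e U) = (e ^+ n)%:E * mu U.
Proof.
move=> e0 mU; rewrite (lebesgue_rV_scale e0 (measurable_dilation e0 mU)).
by rewrite preimage_dilation.
Qed.

Lemma sqr_Lr_norm_dilation r e U u : (0 < r)%R -> (0 < e)%R -> measurable U ->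
  measurable_fun (dilation e U) u ->
  Lr_norm r (dilation e U) u ^+ 2 =
  (e `^ (n%:R * (2 / r)))%:E * Lr_norm r U (fun x => u (e *: x)%R) ^+ 2.
Proof.
move=> r0 e0 mU mu_; have mdU := measurable_dilation e0 mU.
rewrite /Lr_norm !sqr_Lnorm_restrict//.
rewrite (ge0_integral_scaled _ (measurable_scale e) (lebesgue_rV_scale e0) mdU).
- rewrite preimage_dilation//; set I := \int[mu]_(x in U) _.
  have I0 : 0 <= I by apply: integral_ge0 => x _; rewrite lee_fin powR_ge0.
  rewrite (poweRM _ _ I0); last by rewrite lee_fin exprn_ge0// ltW.
  by rewrite poweR_EFin -powR_mulrn; [rewrite -powRrM|exact: ltW].
- by rewrite exprn_ge0// ltW.
- by apply/measurable_EFinP; exact: measurable_normr_powR.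
- by move=> x _; rewrite lee_fin powR_ge0.
Qed.

Lemma sqr_gagliardo s U u : gagliardo s U u ^+ 2 =
  \int[mu \x mu]_(z in U `*` U) ((u z.1 - u z.2) ^+ 2 /
      euclidean_norm (z.1 - z.2) `^ (n%:R + 2 * s))%:E.
Proof.
rewrite /gagliardo sqr_poweR mulVf// poweRe1//.
by apply: integral_ge0 => z _; rewrite lee_fin divr_ge0 ?sqr_ge0 ?powR_ge0.
Qed.

Lemma gagliardo_ge0 s U u : 0 <= gagliardo s U u.
Proof. exact: poweR_ge0. Qed.

Lemma measurable_gagliardo_kernel a U u : measurable U -> measurable_fun U u ->
  measurable_fun (U `*` U) (fun z : 'rV[R]_n * 'rV[R]_n =>
    ((u z.1 - u z.2) ^+ 2 / euclidean_norm (z.1 - z.2) `^ a)%R).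
Proof.
move=> mU mu_; apply: measurable_funM.
  apply: measurable_funX; apply: measurable_funB.
    apply: (@measurable_comp _ _ _ _ _ _ U u (U `*` U) fst) => //.
      by move=> _ [z [Uz1 _] <-].
    exact: measurable_funTS.
  apply: (@measurable_comp _ _ _ _ _ _ U u (U `*` U) snd) => //.
    by move=> _ [z [_ Uz2] <-].
  exact: measurable_funTS.
(* The inverse power of the norm is a real power of a sum of squares of coordinate differences. On
   the diagonal both forms follow the same conventions at [0]. *)
rewrite (_ : (fun _ => _) = (fun z : 'rV[R]_n * 'rV[R]_n =>
    (\sum_(i < n) (rV_coord i z.1 - rV_coord i z.2) ^+ 2) `^ (2^-1 * - a))%R).
  apply: (@measurableT_comp _ _ _ _ _ _ (@powR R ^~ (2^-1 * - a)%R)) => //.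
  apply: measurable_funTS; apply: measurable_sum => i.
  apply: measurable_funX; apply: measurable_funB.
    by apply: measurableT_comp; [exact: measurable_rV_coord|].
  by apply: measurableT_comp; [exact: measurable_rV_coord|].
apply/funext => z; rewrite powRrM powRN powR12_sqrt; last first.
  by apply: sumr_ge0 => i _; exact: sqr_ge0.
by rewrite /euclidean_norm; under eq_bigr do rewrite !mxE.
Qed.

Lemma euclidean_normZ e (x : 'rV[R]_n) : (0 <= e)%R ->
  euclidean_norm (e *: x)%R = (e * euclidean_norm x)%R.
Proof.
move=> e0; rewrite /euclidean_norm.
under eq_bigr do rewrite mxE exprMn.
by rewrite -mulr_sumr sqrtrM ?sqr_ge0// sqrtr_sqr ger0_norm.
Qed.

(** Two Jacobians [e^n] against a kernel of degree [-(n + 2s)] give the exponent [n - 2s]. *)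
Lemma sqr_gagliardo_dilation s e U u : (0 < e)%R -> measurable U ->
  measurable_fun (dilation e U) u ->
  gagliardo s (dilation e U) u ^+ 2 =
  (e `^ (n%:R - 2 * s))%:E * gagliardo s U (fun x => u (e *: x)%R) ^+ 2.
Proof.
move=> e0 mU mu_; have mdU := measurable_dilation e0 mU.
have eX0 : (0 <= e ^+ n)%R by rewrite exprn_ge0// ltW.
have mue : measurable_fun U (fun x => u (e *: x)%R).
  apply: (@measurable_comp _ _ _ _ _ _ (dilation e U) u U (fun x => e *: x)%R) => //.
  by apply: measurable_funTS; exact: (measurable_scale e).
have mk := measurable_gagliardo_kernel (n%:R + 2 * s) mdU mu_.
have mk' := measurable_gagliardo_kernel (n%:R + 2 * s) mU mue.
have k0 (v : 'rV[R]_n -> R) (z : 'rV[R]_n * 'rV[R]_n) : (0 <= (v z.1 - v z.2) ^+ 2 /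
    euclidean_norm (z.1 - z.2) `^ (n%:R + 2 * s))%R.
  by rewrite divr_ge0 ?sqr_ge0 ?powR_ge0.
have kZ (z : 'rV[R]_n * 'rV[R]_n) : ((u (e *: z.1) - u (e *: z.2)) ^+ 2 /
    euclidean_norm (e *: z.1 - e *: z.2) `^ (n%:R + 2 * s) =
    e `^ (- (n%:R + 2 * s)) * ((u (e *: z.1) - u (e *: z.2)) ^+ 2 /
    euclidean_norm (z.1 - z.2) `^ (n%:R + 2 * s)))%R.
  rewrite -scalerBr euclidean_normZ; last exact: ltW.
  by rewrite powRM; [rewrite invfM mulrCA powRN|exact: ltW|exact: sqrtr_ge0].
rewrite -(preimage_dilation U e0) in mk'.
have := ge0_integral_product_scaled (powR_ge0 _ _) eX0 (measurable_scale e)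
  (lebesgue_rV_scale e0) mdU mk mk' (k0 u) (k0 (fun x => u (e *: x)%R)) kZ.
rewrite preimage_dilation// -sqr_gagliardo => ->; rewrite [in RHS]sqr_gagliardo.
congr (_%:E * _).
have eD a b : (e `^ (a + b) = e `^ a * e `^ b)%R by rewrite powRD// (gt_eqF e0) implybT.
rewrite -powR_mulrn; last exact: ltW.
by rewrite -!eD; congr (_ `^ _)%R; ring.
Qed.

Lemma Hs_dilation s e U u : (0 < e)%R -> measurable U ->
  Hs s (dilation e U) u -> Hs s U (fun x => u (e *: x)%R).
Proof.
move=> e0 mU [mu_ u2 uG]; have mdU := measurable_dilation e0 mU.
(* The scaling identities concern squares, so finiteness has to be transferred through them. *)
have sqlty (x y : \bar R) k : 0 <= x -> 0 <= y -> (0 < k)%R ->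
    x < +oo -> x ^+ 2 = k%:E * y ^+ 2 -> y < +oo.
  move=> x0 y0 k0 xoo xy; rewrite ltey; apply/eqP => yoo; move: xy.
  rewrite yoo !expe2 mulyy gt0_muley ?lte_fin// => xx.
  by move: x0 xoo xx; case: x => [x| |].
split.
- apply: (@measurable_comp _ _ _ _ _ _ (dilation e U) u U (fun x => e *: x)%R) => //.
  by apply: measurable_funTS; exact: (measurable_scale e).
- by apply: (sqlty _ _ _ _ _ _ u2 (sqr_Lr_norm_dilation _ _ _ _));
    rewrite ?Lnorm_ge0 ?powR_gt0.
- by apply: (sqlty _ _ _ _ _ _ uG (sqr_gagliardo_dilation _ _ _ _));
    rewrite ?gagliardo_ge0 ?powR_gt0.
Qed.

(** The exponent is the difference between that of the squared seminorm, [n - 2s], and that of the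
    squared [L^q] norm, [2n / q]. *)
Lemma poincare_constant_dilation s q e c U : (0 < q)%R -> (0 < e)%R ->
  measurable U -> poincare_constant s q U c ->
  poincare_constant s q (dilation e U)
    (c * e `^ (n%:R - 2 * s - n%:R * (2 / q)))%R.
Proof.
move=> q0 e0 mU P w Hw; have [mw _ _] := Hw.
have mdU := measurable_dilation e0 mU.
have mEw : measurable_fun (dilation e U) (EFin \o w) by exact/measurable_EFinP.
move=> /(integral_scaled_eq0 (exprn_gt0 n e0) (measurable_scale e)
  (lebesgue_rV_scale e0) mdU mEw).
rewrite preimage_dilation// => /(P _ (Hs_dilation e0 mU Hw)) {}P.
rewrite sqr_Lr_norm_dilation// sqr_gagliardo_dilation//.
rewrite muleA -EFinM -mulrA -powRD ?(gt_eqF e0) ?implybT// subrK mulrC EFinM -muleA.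
by rewrite (muleCA (2^-1)%:E) lee_wpmul2l// lee_fin powR_ge0.
Qed.

End dilation_scaling.

(** * Constants as the only extremals on a set of finite positive measure *)

Section constant_extremals.
Context (R : realType) (n : nat).
Local Open Scope ereal_scope.
Local Notation mu := (lebesgue_rV R n).
Variable U : set 'rV[R]_n.
Hypotheses (mU : measurable U) (Uoo : mu U < +oo) (U0 : 0 < mu U).
Implicit Types (u w : 'rV[R]_n -> R) (s q c m : R).

Let muU : (mu : {measure set 'rV[R]_n -> \bar R}) U = (volume U)%:E.
Proof. by rewrite /volume fineK// ge0_fin_numE. Qed.

Let V_gt0 : (0 < volume U)%R.
Proof. by rewrite -lte_fin -muU. Qed.

Lemma gagliardo_shift s u m : gagliardo s U (fun x => u x - m)%R = gagliardo s U u.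
Proof.
rewrite /gagliardo; congr (_ `^ _); apply: eq_integral => z _.
by congr ((_ ^+ 2 / _)%:E); ring.
Qed.

Lemma Hs_shift s u m : Hs s U u -> Hs s U (fun x => u x - m)%R.
Proof.
move=> [mu_ u2 uG]; split; last by rewrite gagliardo_shift.
  exact: measurable_funB.
apply: (le_lt_trans (Lnorm_restrict_triangle mu mU _ mu_ (measurable_cst (- m)%R))).
  by rewrite ler1n.
rewrite lte_add_pinfty//.
have : 'N[mu]_(2%:E)[(EFin \o cst (- m)%R) \_ U] ^+ 2 < +oo.
  by rewrite Lnorm_restrict_cst// muU poweR_EFin -EFinM ltry.
have := Lnorm_ge0 mu 2%:E ((EFin \o cst (- m)%R) \_ U).
by case: ('N[mu]_ _[ _ ]) => [x| |]//; rewrite ?ltry// expe2 mulyy.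
Qed.

(** Since [U] has finite measure, [L^2] embeds in [L^1]: this is [Lnorm_restrict_jensen] with
    exponent [1]. *)
Lemma Hs_integrable s u : Hs s U u -> mu.-integrable U (EFin \o u).
Proof.
move=> [mu_ u2 _]; apply/integrableP; split; first exact/measurable_EFinP.
have h12 : (0 < 1 :> R)%R && (1 <= 2 :> R)%R by rewrite ltr01 ler1n.
have := Lnorm_restrict_jensen mu mU h12 mu_.
rewrite sqr_Lnorm_restrict//.
under eq_integral do rewrite powRr1//.
set I := \int[mu]_(x in U) _ => H.
suff : I < +oo by [].
rewrite ltey; apply/eqP => Iy; move: H.
rewrite Iy poweRyr ?divr1 ?gt_eqF// leye_eq => /eqP.
apply/eqP; rewrite lt_eqF// muU poweR_EFin.
move: u2; rewrite /Lr_norm; have := Lnorm_ge0 mu 2%:E ((EFin \o u) \_ U).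
by case: ('N[mu]_ _[ _ ]) => [x| |]// _ _; rewrite expe2 -!EFinM ltry.
Qed.

Definition mean u : R := (fine (\int[mu]_(x in U) (u x)%:E) / volume U)%R.

Lemma integral_sub_mean s u : Hs s U u ->
  \int[mu]_(x in U) (u x - mean u)%:E = 0.
Proof.
move=> Hu; have iu := Hs_integrable Hu.
have ic : mu.-integrable U (EFin \o cst (mean u)).
  apply/integrableP; split; first by apply/measurable_EFinP; exact: measurable_cst.
  by rewrite /= (integral_cst_EFin mu mU) muU -EFinM ltry.
under eq_integral do rewrite EFinB.
rewrite (integralB mU iu ic) (integral_cst_EFin mu mU) muU -EFinM divfK ?gt_eqF//.
rewrite fineK ?subee//; exact: integrable_fin_num.
Qed.

(** Cauchy-Schwarz, again as the exponent-[1] case of [Lnorm_restrict_jensen]. It lets the [L^2]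
    norm absorb the contribution of the mean in [sobolev_deficit]. *)
Lemma sqr_mean_le s u : Hs s U u ->
  (mean u ^+ 2 * volume U)%:E <= Lr_norm 2 U u ^+ 2.
Proof.
move=> Hu; have iu := Hs_integrable Hu; have [mu_ u2 _] := Hu.
have h12 : (0 < 1 :> R)%R && (1 <= 2 :> R)%R by rewrite ltr01 ler1n.
have := Lnorm_restrict_jensen mu mU h12 mu_.
rewrite sqr_Lnorm_restrict//.
under eq_integral do rewrite powRr1//.
rewrite /Lr_norm muU poweR_EFin divr1.
have -> : (volume U `^ (2 - 1) = volume U)%R.
  by rewrite (_ : 2 - 1 = 1)%R ?powRr1 ?(ltW V_gt0)//; ring.
set I := \int[mu]_(x in U) _.
have Ifin : I \is a fin_num := integrable_fin_num mU (integrable_abse iu).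
have Jfin : \int[mu]_(x in U) (u x)%:E \is a fin_num := integrable_fin_num mU iu.
have JI : (`|fine (\int[mu]_(x in U) (u x)%:E)| <= fine I)%R.
  rewrite -lee_fin (fineK Ifin) -abse_EFin (fineK Jfin).
  exact: (le_abse_integral mu mU (measurable_int mu iu)).
rewrite /mean -(fineK Ifin); set J := fine (\int[mu]_(x in U) (u x)%:E) in JI *.
have I0 : (0 <= fine I)%R by rewrite (le_trans _ JI).
rewrite poweR_EFin powR_mulrn//.
move: u2; rewrite /Lr_norm; have := Lnorm_ge0 mu 2%:E ((EFin \o u) \_ U).
case: ('N[mu]_ _[ _ ]) => [x| |]// _ _; rewrite expe2 -!EFinM !lee_fin -expr2 => H.
rewrite expr_div_n expr2 -(ler_pM2l V_gt0) mulrA.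
apply: le_trans H.
rewrite [leLHS](_ : _ = J ^+ 2)%R; last by field; rewrite gt_eqF.
by rewrite -real_normK ?num_real// lerXn2r ?nnegrE.
Qed.

Let sqre_lty (x : \bar R) : 0 <= x -> x < +oo ->
  exists2 r : R, x ^+ 2 = r%:E & (0 <= r)%R.
Proof.
case: x => [x| |]// x0 _; exists (x ^+ 2)%R; last exact: sqr_ge0.
by rewrite expe2 -EFinM -expr2.
Qed.

(** Multiplication by [k > 0] preserves [+oo], so a real bound forces finiteness; the remaining
    estimates can then be done in [R]. *)
Let sqre_bounded (k b : R) (x : \bar R) : 0 <= x -> (0 < k)%R ->
  k%:E * x ^+ 2 <= b%:E ->
  exists2 r : R, x ^+ 2 = r%:E & (0 <= r)%R /\ (k * r <= b)%R.
Proof.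
move=> x0 k0; have [xoo|] := ltP x +oo.
  by have [r -> r0] := sqre_lty x0 xoo; rewrite -EFinM lee_fin => krb; exists r.
by rewrite leye_eq => /eqP ->; rewrite expe2 mulyy gt0_muley.
Qed.

(** One inequality for both purposes: dropping the term in [k] gives the lower bound on the
    quotient, and keeping it shows that equality forces [w] to equal its mean. The strict hypothesis
    on [c] is what makes [k] positive. *)
Lemma sobolev_deficit s q c w : (1 < q)%R ->
  ((q - 1) * volume U `^ (1 - 2 / q) < c)%R ->
  poincare_constant s q U c -> Hs s U w ->
  exists2 k : R, (0 < k)%R &
    (volume U `^ (1 - 2 / q))%:E * Lr_norm q U w ^+ 2 +
      k%:E * Lr_norm q U (fun x => w x - mean w)%R ^+ 2 <=
    gagliardo s U w ^+ 2 + Lr_norm 2 U w ^+ 2.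
Proof.
move=> q1 lc P Hw; set l := (volume U `^ _)%R in lc *.
have [mw w2 wG] := Hw.
have l0 : (0 < l)%R by rewrite powR_gt0.
have c0 : (0 < c)%R by apply: lt_trans lc; rewrite mulr_gt0// subr_gt0.
set v := (fun x => w x - mean w)%R.
have Hv : Hs s U v by exact: Hs_shift.
have v0 := integral_sub_mean Hw.
have [mv _ _] := Hv.
have b0 := sqr_mean_le Hw.
have sh : (2 <= q)%R -> Lr_norm q U w ^+ 2 <=
    (mean w ^+ 2 * volume U `^ (2 / q))%:E + (2 * (q - 1))%:E * Lr_norm q U v ^+ 2.
  move=> q2; have := Lnorm_restrict_shift_le mU (mean w) q2 mv (Hs_integrable Hv) v0.
  rewrite (_ : (fun x => mean w + v x)%R = w); last first.
    by apply/funext => x; rewrite /v; ring.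
  by rewrite muU poweR_EFin -EFinM.
have je : (q < 2)%R -> Lr_norm q U w ^+ 2 <=
    (volume U `^ (2 / q - 1))%:E * Lr_norm 2 U w ^+ 2.
  move=> q2; have h02 : (0 < q)%R && (q <= 2)%R by rewrite (lt_trans _ q1)//= ltW.
  by have := Lnorm_restrict_jensen mu mU h02 mw; rewrite muU poweR_EFin.
have [g gE g0] := sqre_lty (gagliardo_ge0 s U w) wG.
have [b bE _] := sqre_lty (Lnorm_ge0 _ _ _) w2.
(* Membership in [Hs] says nothing about [L^q]; the Poincaré inequality supplies finiteness of the
   [L^q] norm of [v]. *)
have := P v Hv v0; rewrite gagliardo_shift gE -EFinM => pc.
have [a aE [a0 ca]] := sqre_bounded (Lnorm_ge0 _ _ _) c0 pc.
move: b0 sh je; rewrite -/(Lr_norm 2 U w) bE -/(Lr_norm q U v) aE lee_fin => b0 sh je.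
have VD x y : (volume U `^ (x + y) = volume U `^ x * volume U `^ y)%R.
  by rewrite powRD// (gt_eqF V_gt0) implybT.
have yle B : Lr_norm q U w ^+ 2 <= B%:E ->
    exists2 y, Lr_norm q U w ^+ 2 = y%:E & (y <= B)%R.
  rewrite -[X in X <= _]mul1e => H.
  have [y -> [_]] := sqre_bounded (Lnorm_ge0 _ _ _) ltr01 H.
  by rewrite mul1r => yB; exists y.
have [q2|q2] := leP 2%R q.
  have [y -> yB] : exists2 y, Lr_norm q U w ^+ 2 = y%:E &
      (y <= mean w ^+ 2 * volume U `^ (2 / q) + 2 * (q - 1) * a)%R.
    by apply: yle; rewrite EFinD EFinM; exact: sh.
  (* Poincaré contributes [2 c a] to the squared seminorm, and the shift inequality multiplied by
     [l] consumes [2 (q - 1) l a] of it. *)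
  exists (2 * (c - (q - 1) * l))%R; first by rewrite mulr_gt0// subr_gt0.
  rewrite -!EFinM -!EFinD lee_fin.
  have lV : (l * volume U `^ (2 / q) = volume U)%R.
    by rewrite /l -VD subrK powRr1// ltW.
  have := ler_wpM2l (ltW l0) yB.
  rewrite mulrDr (mulrCA l) lV; lra.
have [y -> yB] : exists2 y, Lr_norm q U w ^+ 2 = y%:E &
    (y <= volume U `^ (2 / q - 1) * b)%R.
  by apply: yle; rewrite EFinM; exact: je.
(* For [q < 2] the [L^2] term alone covers the [L^q] term, so the whole Poincaré gain remains. *)
exists (2 * c)%R; first by rewrite mulr_gt0.
rewrite -!EFinM -!EFinD lee_fin.
have lV : (l * volume U `^ (2 / q - 1) = 1)%R.
  by rewrite /l -VD (_ : _ + _ = 0)%R ?powRr0//; ring.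
have := ler_wpM2l (ltW l0) yB.
rewrite mulrA lV; lra.
Qed.

Lemma sobolev_quotientE s q u : sobolev_quotient s q U u =
  (gagliardo s U u ^+ 2 + Lr_norm 2 U u ^+ 2) / Lr_norm q U u ^+ 2.
Proof.
rewrite /sobolev_quotient /Hs_norm sqr_poweR mulVf// poweRe1//.
by rewrite adde_ge0// expe2 mule_ge0// ?gagliardo_ge0 ?Lnorm_ge0.
Qed.

Lemma gagliardo_cst s m : gagliardo s U (cst m) = 0.
Proof.
rewrite /gagliardo.
under eq_integral do rewrite /= subrr expr0n/= mul0r.
by rewrite integral0 poweR0r// invr_neq0.
Qed.

Lemma nonzero_cst1 : nonzero_on U (cst 1%R).
Proof.
move=> [N [mN N0 UN]]; have : mu U <= mu N.
  apply: le_measure; rewrite ?inE// => x Ux; apply: UN => /=.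
  by move/(_ Ux)/eqP; rewrite oner_eq0.
by rewrite N0 leNgt U0.
Qed.

(** The constant [1] attains the lower bound [l] of [sobolev_deficit], and every function attaining
    it is almost everywhere constant. *)
Lemma unique_extremal_of_poincare s q c : (1 < q)%R ->
  ((q - 1) * volume U `^ (1 - 2 / q) < c)%R ->
  poincare_constant s q U c -> unique_extremal s q U.
Proof.
move=> q1 lc P; set l := (volume U `^ (1 - 2 / q))%R in lc.
have q0 : (0 < q)%R by apply: lt_trans q1.
have l0 : (0 < l)%R by rewrite powR_gt0.
have norm1 r : (0 < r)%R -> Lr_norm r U (cst 1%R) ^+ 2 = (volume U `^ (2 / r))%:E.
  by move=> r0; rewrite /Lr_norm Lnorm_restrict_cst// expr1n mul1e muU.
have H1 : Hs s U (cst 1%R).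
  split; [exact: measurable_cst| |by rewrite gagliardo_cst].
  have : Lr_norm 2 U (cst 1%R) ^+ 2 < +oo by rewrite norm1// ltry.
  have : 0 <= Lr_norm 2 U (cst 1%R) by exact: Lnorm_ge0.
  by case: (Lr_norm _ _ _) => [x| |]//; rewrite ?ltry// expe2 mulyy.
have Q1 : sobolev_quotient s q U (cst 1%R) = l%:E.
  rewrite sobolev_quotientE gagliardo_cst norm1// norm1// divff// powRr1 ?ltW//.
  rewrite expe2 mul0e add0e inver gt_eqF ?powR_gt0// -EFinM.
  by rewrite /l powRB ?(gt_eqF V_gt0) ?implybT// powRr1// ltW.
have key u : Hs s U u -> nonzero_on U u -> l%:E <= sobolev_quotient s q U u /\
    (sobolev_quotient s q U u = l%:E -> eq_on U u (cst (mean u))).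
  move=> Hu nzu; have [mu_ u2 uG] := Hu.
  have [k k0] := sobolev_deficit q1 lc P Hu.
  have [g gE g0] := sqre_lty (gagliardo_ge0 s U u) uG.
  have [b bE _] := sqre_lty (Lnorm_ge0 _ _ _) u2.
  rewrite sobolev_quotientE gE -/(Lr_norm 2 U u) bE -EFinD -/l => D.
  have kv0 : 0 <= k%:E * Lr_norm q U (fun x => u x - mean u)%R ^+ 2.
    by rewrite mule_ge0 ?lee_fin ?(ltW k0)// expe2 mule_ge0 ?Lnorm_ge0.
  have ly0 : 0 <= l%:E * Lr_norm q U u ^+ 2.
    by rewrite mule_ge0 ?lee_fin ?(ltW l0)// expe2 mule_ge0 ?Lnorm_ge0.
  have [y yE [y0 ly]] := sqre_bounded (Lnorm_ge0 _ _ _) l0 (le_trans (leeDl _ kv0) D).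
  have [a aE [a0 ka]] := sqre_bounded (Lnorm_ge0 _ _ _) k0 (le_trans (leeDr _ ly0) D).
  have Nq0 x : Lr_norm q U x ^+ 2 = 0 -> Lr_norm q U x = 0.
    by rewrite expe2 => /eqP; rewrite mule_eq0 orbb => /eqP.
  (* A nonzero function has positive [L^q] norm, so the quotient is a genuine real division. *)
  have {}y0 : (0 < y)%R.
    rewrite lt_neqAle y0 andbT; apply/eqP => y0'; apply: nzu.
    apply: (Lnorm_restrict_eq0 mU q0 mu_); apply: Nq0.
    by rewrite -y0' in yE.
  move: D; rewrite -/(Lr_norm q U u) yE -/(Lr_norm q U _) aE -!EFinM -EFinD lee_fin => D.
  rewrite inver gt_eqF// -EFinM; split.
    by rewrite lee_fin ler_pdivlMr.
  move=> [/(congr1 (fun z => z * y)%R)]; rewrite divfK ?gt_eqF// => gb.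
  (* Equality in the quotient turns [D] into [k a <= 0], where [a] is the squared distance in [L^q]
     from [u] to its mean. *)
  have {}a0 : a = 0%R.
    apply/eqP; rewrite eq_le a0 andbT -(ler_pM2l k0) mulr0; lra.
  have := Lnorm_restrict_eq0 mU q0 (measurable_funB mu_ (measurable_cst (mean u))).
  rewrite a0 in aE; move=> /(_ _ (Nq0 _ aE)).
  by apply: filterS => x /= H Ux; apply/eqP; rewrite -subr_eq0; apply/eqP/H.
have S1 : sobolev_constant s q U = l%:E.
  apply/eqP; rewrite eq_le; apply/andP; split.
    by apply: ereal_inf_lbound; exists (cst 1%R) => //; split => //; exact: nonzero_cst1.
  by apply: le_ereal_inf_tmp => _ [u [Hu nzu] <-]; have [] := key _ Hu nzu.
exists (cst 1%R); first by split => //; [exact: nonzero_cst1|rewrite Q1 S1].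
move=> v [Hv nzv]; rewrite S1 => Qv; have [_ /(_ Qv) vm] := key _ Hv nzv.
(* The factor is nonzero, since a zero mean would make [v] vanish almost everywhere. *)
exists (mean v).
  by apply/eqP => m0; apply: nzv; move: vm; rewrite m0.
by apply: filterS vm => x /= H Ux; rewrite H// mulr1.
Qed.

End constant_extremals.

Theorem theorem5p4 (R : realType) (n : nat) (Omega : set 'rV[R]_n) (s q c : R)
  (hn : (1 <= n)%N)
  (hOmega : bounded_smooth_domain Omega)
  (hs : 0 < s < 1)
  (hq : 1 < q) (hq_crit : (q%:E < critical_exponent n s)%E)
  (hc : 0 < c) (hpoincare : poincare_constant s q Omega c) :
  (((c / ((q - 1) * volume Omega `^ (1 - 2 / q))) `^ (1 / (2 * s)))%:E
     <= uniqueness_threshold s q Omega)%E.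
Proof.
case: hOmega => O0 oO _ bO _; have mO := open_measurable_rV oO.
have Ooo := lebesgue_rV_bounded bO mO.
have Opos := lebesgue_rV_open_gt0 oO O0.
have OE : lebesgue_rV R n Omega = (volume Omega)%:E.
  by rewrite /volume fineK// ge0_fin_numE// ltW.
have V0 : 0 < volume Omega by rewrite -lte_fin -OE.
have s0 : 0 < s by case/andP: hs.
have q0 : 0 < q by apply: lt_trans hq.
set l := volume Omega `^ (1 - 2 / q).
have l0 : 0 < l by rewrite powR_gt0.
have q1 : 0 < q - 1 by rewrite subr_gt0.
have ql0 : 0 < (q - 1) * l by rewrite mulr_gt0.
set B := c / _; have B0 : 0 < B by rewrite divr_gt0.
(* The claimed bound is itself an admissible [delta]. *)
apply: ereal_sup_ubound; exists (B `^ (1 / (2 * s))) => //.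
split=> [|e /andP[e0 eB]]; first exact: powR_gt0.
have mdO := measurable_dilation e0 mO.
have dO := lebesgue_rV_dilation e0 mO.
have dV : volume (dilation e Omega) = e ^+ n * volume Omega.
  by rewrite /volume dO OE.
apply: (unique_extremal_of_poincare mdO _ _ hq _
  (poincare_constant_dilation q0 e0 mO hpoincare)).
- by rewrite dO OE -EFinM ltry.
- by rewrite dO OE -EFinM lte_fin mulr_gt0// exprn_gt0.
have eD x y : e `^ (x + y) = e `^ x * e `^ y by rewrite powRD// (gt_eqF e0) implybT.
have e2s : e `^ (2 * s) < B.
  have s20 : 0 < 2 * s by rewrite mulr_gt0.
  have := gt0_ltr_powR s20 _ _ eB.
  rewrite !nnegrE powR_ge0 (ltW e0) => /(_ isT isT).
  by rewrite -powRrM div1r mulVf ?gt_eqF// powRr1// ltW.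
rewrite dV powRM; [|by rewrite exprn_ge0// ltW|exact: ltW].
rewrite -powR_mulrn; last exact: ltW.
rewrite -powRrM -/l.
(* The volume of the dilated domain and its Poincaré constant share the factor [e^(n (1 - 2/q))];
   cancelling it leaves [(q - 1) l < c e^(-2s)], which is [e2s]. *)
have -> : n%:R - 2 * s - n%:R * (2 / q) = n%:R * (1 - 2 / q) + - (2 * s) by ring.
rewrite eD mulrCA [ltRHS]mulrCA ltr_pM2l ?powR_gt0// powRN.
rewrite ltr_pdivlMr ?powR_gt0// mulrC -ltr_pdivlMr//.
Qed.
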